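(* Let $n\ge 1$, let $\hat M,\tilde M\in\mathbb{R}^{n\times n}$ satisfy $\hat M\le\tilde M$, and let $\hat q,\tilde q\in\mathbb{R}^n$ satisfy $\hat q\le\tilde q$. Let $\tilde z$ be a solution of the linear complementarity problem (LCP) defined by $\tilde M$ and $\tilde q$, and let $\hat z$ be a solution of the LCP defined by $\hat M$ and $\hat q$. (1) If $\tilde M$ or $\hat M$ is an M-matrix, then $\tilde z\le\hat z$. (2) In addition, suppose that at least one of the following two conditions holds: (a) $\tilde z>o$ and there are indices $i_0,j_0\in\{1,\dots,n\}$ such that $\hat m_{i_0j_0}<\tilde m_{i_0j_0}$ or $\hat q_{i_0}<\tilde q_{i_0}$; (b) $\tilde q=-\tilde M\tilde z$ and there is an index $i_0\in\{1,\dots,n\}$ such that $\hat q_{i_0}<\tilde q_{i_0}$. Then, if $\tilde M$ is invertible with $\tilde M^{-1}>O$, or $\hat M$ is invertible with $\hat M^{-1}>O$, one has $\tilde z<\hat z$.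
   Context: All matrix and vector inequalities are componentwise: $A\le B$ means $a_{ij}\le b_{ij}$ for all $i,j$, and $A<B$ means $a_{ij}<b_{ij}$ for all $i,j$ (similarly for vectors). $o$ denotes the zero vector and $O$ the zero matrix. The entries of $\hat M,\tilde M$ are $\hat m_{ij},\tilde m_{ij}$ and the components of $\hat q,\tilde q$ are $\hat q_i,\tilde q_i$. Given $M\in\mathbb{R}^{n\times n}$ and $q\in\mathbb{R}^n$, a solution of the linear complementarity problem (LCP) defined by $M$ and $q$ is a vector $z\in\mathbb{R}^n$ with $$q+Mz\ge o,\qquad z\ge o,\qquad (q+Mz)^{T}z=0.$$ A matrix $M=(m_{ij})\in\mathbb{R}^{n\times n}$ is called an M-matrix if $m_{ij}\le 0$ for all $i\ne j$, $M$ is invertible, and $M^{-1}\ge O$. *)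

(* Defs.v *)
From HB Require Import structures.
From mathcomp Require Import all_boot all_order all_algebra.
From mathcomp Require Import reals.

Set Implicit Arguments.
Unset Strict Implicit.
Unset Printing Implicit Defensive.

Import Order.TTheory GRing.Theory Num.Theory.
Local Open Scope ring_scope.

Definition mx_le (R : numDomainType) (m n : nat) (A B : 'M[R]_(m, n)) : Prop :=
  forall i j, A i j <= B i j.

(* Strict in every entry, so this is not "mx_le A B and A <> B". *)
Definition mx_lt (R : numDomainType) (m n : nat) (A B : 'M[R]_(m, n)) : Prop :=
  forall i j, A i j < B i j.

Definition lcp_solution (R : numDomainType) (n : nat)
    (M : 'M[R]_n) (q z : 'cV[R]_n) : Prop :=
  [/\ mx_le 0 (q + M *m z), mx_le 0 z & (q + M *m z)^T *m z = 0].

(* [invmx M] is [M] itself when [M] is singular, hence the explicit [unitmx]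
   hypothesis wherever the inverse is compared with zero. *)
Definition M_matrix (R : numFieldType) (n : nat) (M : 'M[R]_n) : Prop :=
  [/\ forall i j, i != j -> M i j <= 0, M \in unitmx & mx_le 0 (invmx M)].

Definition has_pos_inverse (R : numFieldType) (n : nat) (M : 'M[R]_n) : Prop :=
  M \in unitmx /\ mx_lt 0 (invmx M).

(* Main.v *)
(** For any matrix [A] between [Mhat] and [Mtilde] (in particular for both of
    them), [A (zhat - ztilde)] dominates [qtilde - qhat + rhat - rtilde], where
    [r = q + M z] is the residual.

    Where [ztilde_i > zhat_i] complementarity gives [rtilde_i = 0], so with
    [d = ztilde - zhat] one has [(A d)_i <= 0] wherever [d_i > 0]. When the
    off-diagonal entries of [A] are nonpositive this implies [A d^+ <= 0], and
    a nonnegative inverse then forces [d^+ <= 0].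

    Under condition (a) or (b) [rtilde = 0], so [A (zhat - ztilde)] is
    nonnegative with a positive [i0]-th entry, and a positive inverse makes
    [zhat - ztilde] positive. *)
Require Import Defs.
From HB Require Import structures.
From mathcomp Require Import all_boot all_order all_algebra.
From mathcomp Require Import reals.
From mathcomp Require Import ring.

Set Implicit Arguments.
Unset Strict Implicit.
Unset Printing Implicit Defensive.

Import Order.TTheory GRing.Theory Num.Theory.
Local Open Scope ring_scope.

(** The inner product of residual and solution is a vanishing sum of nonnegative terms, so every
    single term vanishes. *)
Lemma lcp_complementary (R : numDomainType) (n : nat) (M : 'M[R]_n)
    (q z : 'cV[R]_n) (i : 'I_n) :
  lcp_solution M q z -> 0 < z i 0 -> (q + M *m z) i 0 = 0.
Proof.
move=> [r_ge0 z_ge0 /matrixP/(_ 0 0) sum0] zi_gt0; rewrite !mxE in sum0.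
have term_ge0 j : true -> 0 <= (q + M *m z)^T 0 j * z j 0.
  move=> _; apply: mulr_ge0; last by have := z_ge0 j 0; rewrite mxE.
  by have := r_ge0 j 0; rewrite !mxE.
have /eqP := psumr_eq0P term_ge0 sum0 (i := i) isT.
by rewrite mulf_eq0 (gt_eqF zi_gt0) orbF [_^T _ _]mxE => /eqP.
Qed.

Lemma mx_le_mulVmx (R : numFieldType) (n : nat) (A : 'M[R]_n) (x : 'cV[R]_n) :
  A \in unitmx -> mx_le 0 (invmx A) -> mx_le 0 (A *m x) -> mx_le 0 x.
Proof.
move=> uA invA_ge0 Ax_ge0 i j.
rewrite -(mulKmx uA x) [leLHS]mxE [leRHS]mxE; apply: sumr_ge0 => k _.
by apply: mulr_ge0; [have := invA_ge0 i k | have := Ax_ge0 k j];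
  rewrite [leLHS]mxE.
Qed.

(** Every row of [invmx A] has a positive weight at [i0], so one positive entry of [A *m x] spreads
    to all entries of [x]. *)
Lemma mx_lt_mulVmx (R : numFieldType) (n : nat) (A : 'M[R]_n) (x : 'cV[R]_n)
    (i0 : 'I_n) :
  has_pos_inverse A -> mx_le 0 (A *m x) -> 0 < (A *m x) i0 0 -> mx_lt 0 x.
Proof.
move=> [uA invA_gt0] Ax_ge0 Ax_gt0 i j.
have {}invA_gt0 k : 0 < invmx A i k by have := invA_gt0 i k; rewrite [ltLHS]mxE.
rewrite -(mulKmx uA x) [ltLHS]mxE [ltRHS]mxE (bigD1 i0) //= !ord1.
apply: ltr_wpDr; last exact: mulr_gt0.
apply: sumr_ge0 => k _; apply: mulr_ge0; first exact: ltW.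
by have := Ax_ge0 k 0; rewrite [leLHS]mxE.
Qed.

Lemma M_matrix_le0 (R : realFieldType) (n : nat) (A : 'M[R]_n)
    (d : 'cV[R]_n) :
  M_matrix A -> (forall i, 0 < d i 0 -> (A *m d) i 0 <= 0) -> mx_le d 0.
Proof.
move=> [offdiag uA invA_ge0] Ad_le0.
pose dplus : 'cV[R]_n := \col_i Num.max (d i 0) 0.
have Adplus_le0 : mx_le 0 (A *m - dplus).
  move=> i j; rewrite ord1 mulmxN [leLHS]mxE [leRHS]mxE oppr_ge0.
  (* If [d i 0 > 0], passing from [d] to [dplus] keeps the diagonal term and can only lower the
     others, since [dplus >= d] meets nonpositive coefficients. Otherwise the diagonal term is zero
     and the others are nonpositive. *)
  have [di_gt0|di_le0] := ltP 0 (d i 0).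
    apply: le_trans (Ad_le0 i di_gt0); rewrite !mxE; apply: ler_sum => k _.
    rewrite mxE; have [<-|neq_ik] := eqVneq i k.
      by rewrite (max_idPl (ltW di_gt0)).
    by apply: ler_wnM2l; [exact: offdiag | rewrite le_max lexx].
  rewrite mxE; apply: sumr_le0 => k _; rewrite mxE.
  have [<-|neq_ik] := eqVneq i k; first by rewrite (max_idPr di_le0) mulr0.
  by apply: mulr_le0_ge0; [exact: offdiag | rewrite le_max lexx orbT].
move=> i j; have := mx_le_mulVmx uA invA_ge0 Adplus_le0 i j.
by rewrite !ord1 !mxE oppr_ge0 ge_max => /andP[].
Qed.

Section Comparison.

Variables (R : realFieldType) (n : nat) (Mhat Mtilde A : 'M[R]_n).
Variables (qhat qtilde zhat ztilde : 'cV[R]_n).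
Hypotheses (le_MhatA : mx_le Mhat A) (le_AMtilde : mx_le A Mtilde).
Hypotheses (le_q : mx_le qhat qtilde).
Hypotheses (zhatP : lcp_solution Mhat qhat zhat).
Hypotheses (ztildeP : lcp_solution Mtilde qtilde ztilde).

Local Notation rhat := (qhat + Mhat *m zhat).
Local Notation rtilde := (qtilde + Mtilde *m ztilde).

(** Summed over [j], this is the exact excess of [A (zhat - ztilde)] over
    [qtilde - qhat + rhat - rtilde] in row [i]. *)
Let gap i j :=
  (A i j - Mhat i j) * zhat j 0 + (Mtilde i j - A i j) * ztilde j 0.

Let zhat_ge0 i : 0 <= zhat i 0.
Proof. by case: zhatP => _ /(_ i 0); rewrite mxE. Qed.

Let ztilde_ge0 i : 0 <= ztilde i 0.
Proof. by case: ztildeP => _ /(_ i 0); rewrite mxE. Qed.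

Let rhat_ge0 i : 0 <= rhat i 0.
Proof. by case: zhatP => /(_ i 0); rewrite [leLHS]mxE. Qed.

Let qr_ge0 i : 0 <= qtilde i 0 - qhat i 0 + rhat i 0.
Proof. by apply: addr_ge0 => //; rewrite subr_ge0. Qed.

Let gap_ge0 i j : 0 <= gap i j.
Proof. by rewrite addr_ge0 // mulr_ge0 // subr_ge0. Qed.

Let mulmx_subE i : (A *m (zhat - ztilde)) i 0 =
  (qtilde i 0 - qhat i 0) + (rhat i 0 - rtilde i 0) + \sum_j gap i j.
Proof.
have -> : \sum_j gap i j = (A *m zhat) i 0 - (Mhat *m zhat) i 0 +
    ((Mtilde *m ztilde) i 0 - (A *m ztilde) i 0).
  rewrite !mxE -!sumrB -big_split /=; apply: eq_bigr => j _.
  by rewrite /gap !mulrBl.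
by rewrite mulmxBr !mxE; ring.
Qed.

Lemma lcp_le : M_matrix A -> mx_le ztilde zhat.
Proof.
move=> MA; suff d_le0 : mx_le (ztilde - zhat) 0.
  by move=> i j; have := d_le0 i j; rewrite !mxE subr_le0.
apply: M_matrix_le0 MA _ => i; rewrite mxE [X in _ + X]mxE subr_gt0 => lt_z.
have r0 := lcp_complementary ztildeP (le_lt_trans (zhat_ge0 i) lt_z).
rewrite -opprB mulmxN [leLHS]mxE mulmx_subE r0 subr0 oppr_le0.
by apply: addr_ge0 => //; exact: sumr_ge0.
Qed.

(** Strictness between [Mhat] and [Mtilde] may lie on either side of [A]. The lower side is weighted
    by [zhat] and the upper one by [ztilde], so both are taken positive. *)
Lemma lcp_lt (i0 : 'I_n) :
  has_pos_inverse A -> rtilde = 0 ->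
  qhat i0 0 < qtilde i0 0 \/
    [/\ mx_lt 0 ztilde, mx_lt 0 zhat & exists j0, Mhat i0 j0 < Mtilde i0 j0] ->
  mx_lt ztilde zhat.
Proof.
move=> invA_gt0 r0 strict; suff d_gt0 : mx_lt 0 (zhat - ztilde).
  by move=> i j; have := d_gt0 i j; rewrite !mxE subr_gt0.
have sum_ge0 i : 0 <= \sum_j gap i j by exact: sumr_ge0.
have AdE i : (A *m (zhat - ztilde)) i 0 =
    (qtilde i 0 - qhat i 0) + rhat i 0 + \sum_j gap i j.
  by rewrite mulmx_subE r0 [(0 : 'cV_n) i 0]mxE subr0.
apply: (mx_lt_mulVmx (i0 := i0) invA_gt0) => [i j|].
  by rewrite ord1 [leLHS]mxE AdE; apply: addr_ge0.
rewrite AdE; case: strict => [lt_q|[ztilde_gt0 zhat_gt0 [j0 lt_M]]].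
  by rewrite ltr_wpDr // ltr_wpDr // subr_gt0.
apply: ltr_wpDl => //; rewrite (bigD1 j0) //=.
apply: ltr_wpDr; first exact: sumr_ge0.
have := ztilde_gt0 j0 0; have := zhat_gt0 j0 0; rewrite mxE => zh zt.
have [lt_MA|le_AM] := ltP (Mhat i0 j0) (A i0 j0).
  by apply: ltr_wpDr; rewrite ?mulr_ge0 ?mulr_gt0 ?subr_ge0 ?subr_gt0.
apply: ltr_wpDl; first by rewrite mulr_ge0 ?subr_ge0.
by rewrite mulr_gt0 ?subr_gt0 // (le_lt_trans le_AM).
Qed.

End Comparison.

Theorem theorem3p1 (R : realType) (n : nat) (n_ge1 : (1 <= n)%N)
    (Mhat Mtilde : 'M[R]_n) (le_M : mx_le Mhat Mtilde)
    (qhat qtilde : 'cV[R]_n) (le_q : mx_le qhat qtilde)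
    (ztilde : 'cV[R]_n) (ztildeP : lcp_solution Mtilde qtilde ztilde)
    (zhat : 'cV[R]_n) (zhatP : lcp_solution Mhat qhat zhat)
    (MM : M_matrix Mtilde \/ M_matrix Mhat) :
  mx_le ztilde zhat /\
  ((mx_lt 0 ztilde /\
      (exists i0 j0 : 'I_n,
         Mhat i0 j0 < Mtilde i0 j0 \/ qhat i0 0 < qtilde i0 0)) \/
   (qtilde = - (Mtilde *m ztilde) /\
      (exists i0 : 'I_n, qhat i0 0 < qtilde i0 0)) ->
   has_pos_inverse Mtilde \/ has_pos_inverse Mhat ->
   mx_lt ztilde zhat).
Proof.
have le_refl (A : 'M[R]_n) : mx_le A A by move=> i j.
have le_z : mx_le ztilde zhat.
  by case: MM => MA; apply: (lcp_le _ _ le_q zhatP ztildeP MA).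
split=> // cond pos_inv.
have [r0 [i0 strict]] : qtilde + Mtilde *m ztilde = 0 /\
    exists i0, qhat i0 0 < qtilde i0 0 \/
      [/\ mx_lt 0 ztilde, mx_lt 0 zhat &
          exists j0, Mhat i0 j0 < Mtilde i0 j0].
  case: cond => [[zt_gt0 [i0 [j0 lt_i0]]]|[-> [i0 lt_q]]]; last first.
    by rewrite addNr; split=> //; exists i0; left.
  split.
    (* Under (a) complementarity applies in every row, because all of [ztilde] is positive. *)
    apply/matrixP => i j; rewrite ord1 (lcp_complementary ztildeP) ?mxE //.
    by have := zt_gt0 i 0; rewrite mxE.
  exists i0; case: lt_i0 => [lt_M|lt_q]; [right | by left].
  split=> //; last by exists j0.
  (* Positivity of [zhat] is inherited from [ztilde] through part (1). *)
  by move=> i j; apply: lt_le_trans (le_z i j).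
by case: pos_inv => pA; apply: (lcp_lt _ _ le_q zhatP ztildeP pA r0 strict).
Qed.
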